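(* Let $K$ be a field and let $A$ be a finite-dimensional $K$-algebra. There is a bijection between the set of isomorphism classes of projective indecomposable $A$-modules and the set of isomorphism classes of simple $A$-modules, given by matching a projective indecomposable module $P$ with a simple module $S$ if and only if there exists a surjective $A$-module homomorphism $P \to S$.
   Context: Conventions: $K$ is an arbitrary field (not necessarily algebraically closed). Algebras are unital but need not be commutative. ''Module'' means left $A$-module, not necessarily finitely generated. A module is simple if it is nonzero and has no submodules other than $0$ and itself. A module is indecomposable if it is nonzero and has no direct summands other than $0$ and itself. A projective indecomposable module is a module that is both projective and indecomposable (it is not assumed to be finitely generated). *)

(* Defs.v *)
From HB Require Import structures.
From mathcomp Require Import all_boot all_order all_algebra.
From mathcomp Require Import boolp.

Set Implicit Arguments.
Unset Strict Implicit.
Unset Printing Implicit Defensive.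

Import GRing.Theory.
Local Open Scope ring_scope.

(* [algType K] and [lmodType A] are used rather than [falgType K] because the
   latter excludes the zero algebra. *)
Definition finite_dimensional (K : fieldType) (V : lmodType K) : Prop :=
  exists n : nat, inhabited (Vector.axiom n V).

Section Modules.
Variable A : pzRingType.
Implicit Types M N P S : lmodType A.

(* Submodules are boolean predicates closed under the module operations; with
   the classical axioms of [boolp], every subset is of this form. *)

Definition nonzero_module M : Prop := exists x : M, x != 0.

Definition simple_module M : Prop :=
  nonzero_module M /\
  forall U : {pred M}, GRing.submod_closed U ->
    U =i pred1 (0 : M) \/ U =i predT.

Definition direct_summand M (U : {pred M}) : Prop :=
  GRing.submod_closed U /\
  exists V : {pred M},
    [/\ GRing.submod_closed V,
        forall x : M, x \in U -> x \in V -> x = 0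
      & forall x : M, exists u v : M, [/\ u \in U, v \in V & x = u + v]].

Definition indecomposable_module M : Prop :=
  nonzero_module M /\
  forall U : {pred M}, direct_summand U ->
    U =i pred1 (0 : M) \/ U =i predT.

Definition surjective_hom M N (f : {linear M -> N}) : Prop :=
  forall y : N, exists x : M, f x = y.

Definition projective_module P : Prop :=
  forall (M N : lmodType A) (g : {linear M -> N}) (f : {linear P -> N}),
    surjective_hom g ->
    exists h : {linear P -> M}, forall x : P, g (h x) = f x.

Definition projective_indecomposable P : Prop :=
  projective_module P /\ indecomposable_module P.

Definition isomorphic_modules M N : Prop :=
  exists f : {linear M -> N}, bijective f.

(* The type of isomorphism classes of the modules satisfying [Q], each class
   being the collection of all modules isomorphic to a fixed one.  The collections
   are plain predicates because [set (lmodType A)] is universe inconsistent. *)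
Definition iso_classes (Q : lmodType A -> Prop) :=
  {C : lmodType A -> Prop | exists M, Q M /\ C = isomorphic_modules M}.

Definition iso_class (Q : lmodType A -> Prop) M (hM : Q M) : iso_classes Q :=
  exist _ (isomorphic_modules M) (ex_intro _ M (conj hM erefl)).

End Modules.

(* Main.v *)
Require Import Defs.
From HB Require Import structures.
From mathcomp Require Import all_boot all_order all_algebra.
From mathcomp Require Import boolp classical_sets functions fsbigop.

(** The finite-dimensionality of [A] is used three times, on left ideals seen as
subspaces of [A]; everything else is lifting along surjections.

Covers of simple modules.  Let [S] be simple, and let [L] be a left ideal of
minimal dimension with [L S <> 0].  Choosing [e \in L] and [s != 0] with
[e s = s], minimality gives [L e = L], so right multiplication by [e] is
injective on [L], and the [x \in L] with [x e = e] is idempotent.  Minimality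
also makes [x A x] local: its elements that do not annihilate [S] are invertible
([local_idempotent_exists]).  Therefore [A x] is a projective indecomposable
module with a surjection [f] onto [S] such that every endomorphism [h] with
[f \o h = f] is bijective ([local_idempotent_cover]); this last property
([local_cover]) takes the place of Fitting's lemma and of radicals below.

Uniqueness on the projective side.  If [P'] is another projective indecomposable
module above [S], lift the two surjections through one another.  The composite
[P -> P' -> P] respects [f], so it is bijective, [P] is a nonzero direct summand
of [P'], and [P] is isomorphic to [P'] ([local_cover_unique]).

Uniqueness on the simple side.  Let [g : P -> S'] be a local cover and [f : P -> S]
another surjection.  If some [x] had [f x = 0] but [g x != 0], then lifting [g]
along [a |-> a g x] would give an endomorphism [h] of [P] with values in [A x],
[g \o h = g] and [f \o h = 0], which contradicts the bijectivity of [h].  So [g]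
factors through [f], and [S] is isomorphic to [S'] ([local_cover_top_unique]).

Existence of a simple quotient of [P], which is not assumed finitely generated.
A projective module is a summand of a free one, so a nonzero one has a nonzero
linear form [P -> A] ([projective_linear_form]).  Pulling back a left ideal of [A]
of maximal dimension among those not containing all values of the form
yields a maximal submodule of [P] ([maximal_submodule_of_linear_form]). *)

Set Implicit Arguments.
Unset Strict Implicit.
Unset Printing Implicit Defensive.

Import GRing.Theory.
Local Open Scope quotient_scope.
Local Open Scope classical_set_scope.
Local Open Scope ring_scope.

(** * Linear maps and isomorphisms *)

(** Turns a function proved linear into a bundled map inside a proof. *)
Lemma linear_bundle (A : pzRingType) (M N : lmodType A) (f : M -> N) :
  linear f -> exists g : {linear M -> N}, g =1 f.
Proof.
move=> lf.
pose F := GRing.isLinear.Build A M N *:%R f lf.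
pose g : {linear M -> N} := HB.pack f F.
by exists g.
Qed.

Lemma inj_surj_bij (T T' : Type) (f : T -> T') :
  injective f -> (forall y, exists x, f x = y) -> bijective f.
Proof.
move=> fI fS; pose g y := sval (cid (fS y)).
have gK : cancel g f by move=> y; exact: svalP (cid (fS y)).
by exists g => // x; apply: fI; rewrite gK.
Qed.

Section Isomorphism.
Variable A : pzRingType.
Implicit Types M N P S : lmodType A.

Lemma iso_refl M : isomorphic_modules M M.
Proof. by exists idfun; exists idfun. Qed.

Lemma iso_sym M N : isomorphic_modules M N -> isomorphic_modules N M.
Proof.
move=> [f [g fK gK]]; have [h hE] := linear_bundle (can2_linear fK gK).
by exists h; exists f => x; rewrite hE.
Qed.

Lemma iso_trans M N P :
  isomorphic_modules M N -> isomorphic_modules N P -> isomorphic_modules M P.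
Proof.
by move=> [f fB] [g gB]; exists (g \o f : {linear _ -> _}); exact: bij_comp.
Qed.

Lemma eq_iso_modules M N :
  isomorphic_modules M = isomorphic_modules N <-> isomorphic_modules M N.
Proof.
split=> [->|MN]; first exact: iso_refl.
apply/funext => P; apply/propext; split=> [MP|]; last exact: iso_trans MN.
exact: iso_trans (iso_sym MN) MP.
Qed.

Lemma iso_class_eq Q M N (hM : Q M) (hN : Q N) :
  iso_class hM = iso_class hN <-> isomorphic_modules M N.
Proof.
rewrite -eq_iso_modules; split=> [[]//|MN].
by apply: eq_exist.
Qed.

Lemma iso_classP Q (C : iso_classes Q) : exists M (hM : Q M), C = iso_class hM.
Proof.
case: C => C hC; have [M [hM CM]] := hC.
by exists M, hM; apply: eq_exist.
Qed.

(** * Simple modules *)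

Definition hom_kernel M N (f : {linear M -> N}) : {pred M} := fun x => f x == 0.

Definition hom_range M N (f : {linear M -> N}) : {pred N} :=
  fun y => `[< exists x, f x = y >].

Lemma in_kernelP M N (f : {linear M -> N}) x :
  reflect (f x = 0) (x \in hom_kernel f).
Proof. exact: eqP. Qed.

Lemma in_rangeP M N (f : {linear M -> N}) y :
  reflect (exists x, f x = y) (y \in hom_range f).
Proof. exact: asboolP. Qed.

Lemma kernel_submod_closed M N (f : {linear M -> N}) :
  GRing.submod_closed (hom_kernel f).
Proof.
split=> [|a x y /in_kernelP fx0 /in_kernelP fy0]; apply/in_kernelP.
  exact: linear0.
by rewrite linearP fx0 fy0 scaler0 addr0.
Qed.

Lemma range_submod_closed M N (f : {linear M -> N}) :
  GRing.submod_closed (hom_range f).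
Proof.
split=> [|a _ _ /in_rangeP[x <-] /in_rangeP[y <-]]; apply/in_rangeP.
  by exists 0; exact: linear0.
by exists (a *: x + y); exact: linearP.
Qed.

Lemma hom_to_simple_surjective P S (f : {linear P -> S}) p :
  simple_module S -> f p != 0 -> surjective_hom f.
Proof.
move=> [_ simS] fp0 y; apply/in_rangeP.
have [E|->//] := simS _ (range_submod_closed f).
have fpf : f p \in hom_range f by apply/in_rangeP; exists p.
by move: fpf fp0; rewrite E inE => ->.
Qed.

Lemma hom_from_simple_injective S N (f : {linear S -> N}) s :
  simple_module S -> f s != 0 -> injective f.
Proof.
move=> [_ simS] fs0 x y fxy.
have [E|E] := simS _ (kernel_submod_closed f); last first.
  have /in_kernelP fs : s \in hom_kernel f by rewrite E.
  by rewrite fs eqxx in fs0.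
apply/eqP; rewrite -subr_eq0 -[_ == 0]/(x - y \in pred1 0) -E.
by apply/in_kernelP; rewrite linearB fxy subrr.
Qed.

Lemma surjective_neq0 P S (f : {linear P -> S}) :
  nonzero_module S -> surjective_hom f -> exists p, f p != 0.
Proof. by move=> [s s0] fS; have [p fp] := fS s; exists p; rewrite fp. Qed.

Lemma scale_linear M (m : M) : linear (fun a : A^o => (a : A) *: m).
Proof. by move=> a x y; rewrite scalerDl scalerA. Qed.

Lemma simple_generated S (s t : S) :
  simple_module S -> s != 0 -> exists a : A, t = a *: s.
Proof.
move=> simS s0; have [f fE] := linear_bundle (scale_linear s).
have f1 : f 1 != 0 by rewrite fE scale1r.
have [a fa] := hom_to_simple_surjective simS f1 t.
by exists a; rewrite -fa fE.
Qed.

(** The hypothesis on kernels makes [f p |-> g p] a well-defined map [S -> S'], and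
a nonzero map between simple modules is bijective.  One inclusion of kernels is
therefore enough. *)
Lemma iso_simple_of_kernels P S S' (f : {linear P -> S}) (g : {linear P -> S'}) :
  simple_module S -> simple_module S' -> surjective_hom f -> surjective_hom g ->
  (forall p, f p = 0 -> g p = 0) -> isomorphic_modules S S'.
Proof.
move=> simS simS' fS gS fg.
pose h s := g (sval (cid (fS s))).
have hE p : h (f p) = g p.
  apply/eqP; rewrite -subr_eq0 -linearB; apply/eqP/fg.
  by rewrite linearB (svalP (cid (fS (f p)))) subrr.
have h_lin : linear h.
  move=> a s t; have [[p <-] [q <-]] := (fS s, fS t).
  by rewrite -linearP !hE linearP.
have [k kE] := linear_bundle h_lin.
have [p gp0] := surjective_neq0 simS'.1 gS.
have kp0 : k (f p) != 0 by rewrite kE hE.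
exists k; apply: inj_surj_bij.
  exact: hom_from_simple_injective kp0.
exact: hom_to_simple_surjective kp0.
Qed.

(** * Local covers *)

(** For a projective [P] and a simple [S] this says that [f] is a projective cover.
The lifting property is all that is needed of covers, and it does not mention
superfluous submodules or the radical. *)
Definition local_cover P S (f : {linear P -> S}) : Prop :=
  surjective_hom f /\
  forall h : {linear P -> P}, (forall p, f (h p) = f p) -> bijective h.

(** Lifting [f] and [f'] through each other gives [h : P -> P'] and [h' : P' -> P]
with [h' \o h] bijective by locality.  Hence [P'] is the direct sum of the range
of [h] and the kernel of [h'], and the range is nonzero because [f] is. *)
Lemma local_cover_unique P P' S (f : {linear P -> S}) (f' : {linear P' -> S}) :
  nonzero_module S -> projective_module P -> local_cover f ->
  projective_indecomposable P' -> surjective_hom f' ->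
  isomorphic_modules P P'.
Proof.
move=> S0 projP [fS floc] [projP' [_ indP']] f'S.
have [h hE] := projP _ _ f' f f'S; have [h' h'E] := projP' _ _ f f' fS.
have [k hK kK] : bijective (h' \o h).
  by apply: (floc (h' \o h : {linear _ -> _})) => p /=; rewrite h'E hE.
have h_inj : injective h by move=> x y hxy; apply: (can_inj hK) => /=; rewrite hxy.
exists h; apply: inj_surj_bij => // y.
apply/in_rangeP; have [||->//] := indP' (hom_range h).
- split; first exact: range_submod_closed.
  exists (hom_kernel h'); split=> [|x|x]; first exact: kernel_submod_closed.
    move=> /in_rangeP[p <-] /in_kernelP h'h0.
    by rewrite -(hK p) /= h'h0 -[X in k X](linear0 (h' \o h)) hK linear0.
  (* [h \o k \o h'] is the projection of [P'] onto the range of [h]. *)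
  exists (h (k (h' x))), (x - h (k (h' x))); split.
  + by apply/in_rangeP; exists (k (h' x)).
  + by apply/in_kernelP; rewrite linearB; have /= -> := kK (h' x); rewrite subrr.
  + by rewrite addrC subrK.
- move=> E; have [p fp0] := surjective_neq0 S0 fS.
  have: h p \in hom_range h by apply/in_rangeP; exists p.
  by rewrite E inE => /eqP hp0; rewrite -hE hp0 linear0 eqxx in fp0.
Qed.

(** An [x] in the kernel of [f] with [g x != 0] would produce an endomorphism of [P]
that respects [g] but is killed by [f]; locality of [g] forbids this. *)
Lemma local_cover_top_unique P S S' (f : {linear P -> S}) (g : {linear P -> S'}) :
  simple_module S -> simple_module S' -> projective_module P ->
  surjective_hom f -> local_cover g -> isomorphic_modules S S'.
Proof.
move=> simS simS' projP fS [gS gloc].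
apply: (iso_simple_of_kernels simS simS' fS gS) => x fx0.
apply: contrapT => /eqP gx0.
have [v vE] := linear_bundle (scale_linear (g x)).
have v1 : v 1 != 0 by rewrite vE scale1r.
have [k kE] := projP _ _ v g (hom_to_simple_surjective simS' v1).
have [w wE] := linear_bundle (scale_linear x).
(* [h p = k p *: x], where [k : P -> A] satisfies [k p *: g x = g p]. *)
pose h : {linear P -> P} := w \o k.
have gh p : g (h p) = g p by rewrite -[RHS]kE vE /= wE linearZ.
have [h' _ hK] := gloc h gh.
have [q fq0] := surjective_neq0 simS.1 fS.
by move: fq0; rewrite -(hK q) /= wE linearZ /= fx0 scaler0 eqxx.
Qed.

End Isomorphism.

(** * Submodules, quotients and free modules *)

Section SubQuotient.
Variables (A : pzRingType) (M : lmodType A) (U : {pred M}).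
Hypothesis hU : GRing.submod_closed U.

HB.instance Definition _ :=
  GRing.isSubmodClosed.Build A M U (GRing.submod_closed_semi hU).

(** The proof of closure is an argument of the type so that the module structure
can be found from the type alone. *)
Definition submodule of GRing.submod_closed U := {x : M | x \in U}.
HB.instance Definition _ := SubChoice.on (submodule hU).
HB.instance Definition _ := [SubChoice_isSubLmodule of submodule hU by <:].

Definition quotient_module := Quotient.quot U.
HB.instance Definition _ := EqQuotient.on quotient_module.
HB.instance Definition _ := GRing.Zmodule.on quotient_module.
HB.instance Definition _ := ZmodQuotient.on quotient_module.

Local Notation Q := quotient_module.
Local Notation quo := (\pi_Q : M -> Q).

Lemma quotient_eq x y : (quo x == quo y) = (x - y \in U).
Proof. exact: esym (Quotient.idealrBE _ x y). Qed.

Definition quotient_scale (a : A) (x : Q) : Q := quo (a *: repr x).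

Lemma quotient_scaleE a x : quotient_scale a (quo x) = quo (a *: x).
Proof.
apply/eqP; rewrite quotient_eq -scalerBr; apply: rpredZ.
by rewrite -quotient_eq reprK.
Qed.

Fact quotient_scaleA a b x :
  quotient_scale a (quotient_scale b x) = quotient_scale (a * b) x.
Proof.
rewrite -[x]reprK (quotient_scaleE b (repr x)).
by rewrite (quotient_scaleE a (b *: repr x)) (quotient_scaleE _ (repr x)) scalerA.
Qed.

Fact quotient_scale1 : left_id 1 quotient_scale.
Proof. by move=> x; rewrite -[x]reprK quotient_scaleE scale1r. Qed.

Fact quotient_scaleDr : right_distributive quotient_scale +%R.
Proof.
move=> a x y; rewrite -[x]reprK -[y]reprK -raddfD !quotient_scaleE scalerDr.
exact: raddfD.
Qed.

Fact quotient_scaleDl x : {morph quotient_scale^~ x : a b / a + b}.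
Proof.
by move=> a b; rewrite -[x]reprK !quotient_scaleE scalerDl raddfD.
Qed.

HB.instance Definition _ := GRing.Zmodule_isLmodule.Build A quotient_module
  quotient_scaleA quotient_scale1 quotient_scaleDr quotient_scaleDl.

Lemma quotient_projection :
  exists f : {linear M -> Q}, surjective_hom f /\ forall x, f x = 0 <-> x \in U.
Proof.
have quo_lin : linear quo.
  by move=> a x y; rewrite raddfD; congr (_ + _); exact/esym/quotient_scaleE.
have [f fE] := linear_bundle quo_lin; exists f; split=> [y|x].
  by exists (repr y); rewrite fE reprK.
rewrite fE -[x in x \in U]subr0 -quotient_eq raddf0.
by split=> [->|/eqP].
Qed.

End SubQuotient.

(** Submodules of the quotient pull back to submodules of [M] that contain [U]. *)
Lemma maximal_quotient_simple (A : pzRingType) (M : lmodType A) (U : {pred M})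
    (hU : GRing.submod_closed U) p :
  p \notin U ->
  (forall V : {pred M}, GRing.submod_closed V -> {subset U <= V} ->
     forall v, v \in V -> v \notin U -> V =i predT) ->
  simple_module (quotient_module hU).
Proof.
move=> pU Umax; have [f [fS fU]] := quotient_projection hU.
split.
  by exists (f p); apply: contraNneq pU => /fU.
move=> W [W0 WZ]; case: (pselect (exists2 v, f v \in W & v \notin U)).
  move=> [v vW vU]; right => y; have [x <-] := fS y.
  have V_closed : GRing.submod_closed ((fun x => f x \in W) : {pred M}).
    split=> [|a u w uW wW]; rewrite unfold_in; first by rewrite linear0.
    by rewrite linearP; apply: WZ.
  have UV : {subset U <= (fun x => f x \in W)}.
    by move=> u /fU fu0; rewrite unfold_in fu0.
  by have := Umax _ V_closed UV v vW vU x; rewrite unfold_in => ->.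
move=> WU; left => y; rewrite inE; apply/idP/eqP => [|->//].
have [x <-] := fS y => fxW; apply/fU/negPn/negP => xU; apply: WU.
by exists x.
Qed.

Section FreeModule.
Variables (A : pzRingType) (I : choiceType).

Definition finite_support : {pred I -> A^o} :=
  fun f => `[< exists s : seq I, forall i, i \notin s -> f i = 0 >].

Lemma finite_supportP f :
  reflect (exists s : seq I, forall i, i \notin s -> f i = 0)
          (f \in finite_support).
Proof. exact: asboolP. Qed.

Lemma finite_support_closed : GRing.submod_closed finite_support.
Proof.
split=> [|a f g /finite_supportP[s sf] /finite_supportP[t tg]].
  by apply/finite_supportP; exists [::].
apply/finite_supportP; exists (s ++ t) => i.
rewrite mem_cat => /norP[/sf fi0 /tg gi0].
by rewrite -[LHS]/(a *: f i + g i) fi0 gi0 scaler0 addr0.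
Qed.

(** The free module on [I], as the finitely supported functions [I -> A]. *)
Definition free_module := submodule finite_support_closed.

Lemma free_module_support (f : free_module) :
  exists s : seq I, forall i, i \notin s -> val f i = 0.
Proof. exact/finite_supportP/(valP f). Qed.

(** The universal property of the free module.  The sum is computed over any list
covering the support, which lets two functions share one list. *)
Lemma free_module_eval (M : lmodType A) (m : I -> M) :
  exists e : {linear free_module -> M}, forall f s,
    uniq s -> (forall i, i \notin s -> val f i = 0) ->
    e f = \sum_(i <- s) (val f i : A) *: m i.
Proof.
pose e (f : free_module) := \sum_(i \in [set: I]) (val f i : A) *: m i.
have eE f s : uniq s -> (forall i, i \notin s -> val f i = 0) ->
    e f = \sum_(i <- s) (val f i : A) *: m i.
  move=> s_uniq sP; rewrite /e (fsbigE s) //.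
    by apply: eq_bigl => i; rewrite in_setT.
  by move=> i _ /sP->; rewrite scale0r.
have e_lin : linear e.
  move=> a f g; have [t ft] := free_module_support f.
  have [u gu] := free_module_support g; pose s := undup (t ++ u).
  have s_uniq : uniq s by exact: undup_uniq.
  have sf i : i \notin s -> val f i = 0.
    by rewrite mem_undup mem_cat => /norP[/ft].
  have sg i : i \notin s -> val g i = 0.
    by rewrite mem_undup mem_cat => /norP[_ /gu].
  have valE i : val (a *: f + g) i = (a : A) * val f i + val g i by [].
  rewrite !(eE _ s) // => [|i si]; last by rewrite valE sf ?sg ?mulr0 ?addr0.
  rewrite scaler_sumr -big_split; apply: eq_bigr => i _ /=.
  by rewrite scalerA -scalerDl.
by have [h hE] := linear_bundle e_lin; exists h => f s; rewrite hE; exact: eE.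
Qed.

End FreeModule.

(** The surjection from the free module on the elements of [P] onto [P] splits, and
a coordinate of the section which does not vanish at [p] is the wanted form. *)
Lemma projective_linear_form (A : pzRingType) (P : lmodType A) (p : P) :
  projective_module P -> p != 0 -> exists f : {linear P -> A^o}, f p != 0.
Proof.
move=> projP p0; have [e eE] := free_module_eval (fun x : P => x).
have eS : surjective_hom e.
  move=> x; pose d : P -> A^o := fun y => (y == x)%:R.
  have dP : d \in @finite_support A P.
    apply/finite_supportP; exists [:: x] => y; rewrite inE /d.
    by move=> /negPf->.
  exists (Sub d dP); rewrite (eE _ [:: x]) //= => [|y].
    by rewrite big_seq1 /d eqxx scale1r.
  by rewrite inE /d => /negPf->.
have [h hE] := projP _ _ e idfun eS.
have [q hpq] : exists q, val (h p) q != 0.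
  apply: contrapT => /forallNP hp0.
  have hp i : val (h p) i = 0 by apply/eqP/negPn/negP.
  by move: (hE p) p0; rewrite (eE _ [::]) // big_nil /= => <-; rewrite eqxx.
have coord_lin : linear (fun x => val (h x) q : A^o).
  by move=> a x y; rewrite linearP.
by have [f fE] := linear_bundle coord_lin; exists f; rewrite fE.
Qed.

(** * Local idempotents and the covers they generate *)

Section LocalIdempotent.
Variable A : pzRingType.

(** The elements [b] with [x b = b = b x] form the corner ring [x A x], whose unit is
[x]; the last clause says that the elements of this ring which act nontrivially
on [S] are invertible in it. *)
Definition local_idempotent (S : lmodType A) (x : A) : Prop :=
  [/\ x * x = x, exists s : S, x *: s != 0 &
    forall b : A, x * b = b -> b * x = b -> (exists s : S, b *: s != 0) ->
      exists2 c, c * b = x /\ b * c = x & x * c = c /\ c * x = c].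

(** This is [A x] when [x] is idempotent. *)
Definition idempotent_left_ideal (x : A) : {pred A^o} := fun y => (y : A) * x == y.

Lemma idempotent_left_ideal_closed x : GRing.submod_closed (idempotent_left_ideal x).
Proof.
split=> [|a y z /eqP yx /eqP zx]; rewrite unfold_in; first by rewrite mul0r.
by rewrite -[a *: y]/((a : A) * y) mulrDl -mulrA yx zx.
Qed.

(** Homomorphisms out of [A x] are determined by the image of [x].  Projectivity
amounts to lifting that image, and the endomorphisms of [A x] are the right
multiplications by elements of [x A x].  A decomposition [A x = W + W'] splits
[x = w + w'] in [x A x]; one of the two components acts nontrivially on [S], hence
is invertible, and its summand contains [x]. *)
Lemma local_idempotent_cover (S : lmodType A) (x : A) :
  simple_module S -> local_idempotent S x ->
  exists (P : lmodType A) (f : {linear P -> S}),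
    projective_indecomposable P /\ local_cover f.
Proof.
move=> simS [xx [s xs] xloc].
pose P : lmodType A := submodule (idempotent_left_ideal_closed x).
have val_x (y : P) : (val y : A) * x = val y by exact/eqP/(valP y).
pose mk (a : A) (ax : a * x = a) : P :=
  exist (fun y => is_true (y \in idempotent_left_ideal x)) a (introT eqP ax).
pose e : P := mk x xx.
have genP (y : P) : y = (val y : A) *: e.
  by apply: val_inj; rewrite /= -[RHS]/(val y * x) val_x.
have val_scale (a : A) (y : P) : val (a *: y) = a * val y by [].
have eval_lin (M : lmodType A) (m : M) : linear (fun y : P => (val y : A) *: m).
  by move=> a y z; rewrite scalerA -scalerDl.
have proj : projective_module P.
  move=> M N g f gS; have [m gm] := gS (f e).
  have [h hE] := linear_bundle (eval_lin M m).
  by exists h => y; rewrite hE linearZ /= gm [in RHS](genP y) linearZ.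
have [f fE] := linear_bundle (eval_lin S s).
have fe0 : f e != 0 by rewrite fE.
exists P, f; split; first split=> //; split.
- by exists e; apply: contraNneq fe0 => ->; rewrite linear0.
- have full (W W' : {pred P}) w w' :
      GRing.submod_closed W -> GRing.submod_closed W' ->
      (forall y, y \in W -> y \in W' -> y = 0) -> w \in W -> w' \in W' ->
      e = w + w' -> (val w : A) *: s != 0 -> forall y, y \in W.
    move=> hW hW' WW'0 wW w'W' eww' ws.
    have [_ WB] := GRing.submod_closedB hW.
    have [_ W'B] := GRing.submod_closedB hW'.
    have [_ WZ] := GRing.submod_closed_semi hW.
    have [_ W'Z] := GRing.submod_closed_semi hW'.
    have xw : x *: w = w.
      apply/eqP; rewrite -subr_eq0; apply/eqP/WW'0.
        by apply: WB; first exact: WZ.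
      suff -> : x *: w - w = w' - x *: w' by apply: W'B; last exact: W'Z.
      apply/eqP; rewrite subr_eq addrAC -subr_eq opprK -scalerDr [w' + w]addrC -eww'.
      by apply/eqP/val_inj; rewrite val_scale.
    have [|||c [cw _] _] := xloc (val w).
    + by rewrite -val_scale xw.
    + exact: val_x.
    + by exists s.
    move=> y; rewrite (genP y); apply/WZ.
    suff -> : e = c *: w by exact: WZ.
    by apply: val_inj; rewrite val_scale cw.
  move=> U [hU [V [hV UV0 UVT]]].
  have [u [v [uU vV euv]]] := UVT e.
  have [us|us0] := boolP ((val u : A) *: s == 0); last first.
    by right => y; rewrite (full U V u v).
  have VT : forall y, y \in V.
    apply: (full V U v u) => // [y yV yU||]; [exact: UV0|by rewrite addrC|].
    apply: contra_neq xs => vs0; rewrite -[x]/(val e) euv.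
    by rewrite raddfD scalerDl (eqP us) vs0 addr0.
  left => y; rewrite inE; apply/idP/eqP => [yU|->]; first exact: UV0.
  exact: hU.1.
- exact: hom_to_simple_surjective fe0.
- (* [h] is right multiplication by [b], and [b] is inverted by [c]. *)
  move=> h fh; pose b : A := val (h e).
  have hE y : val (h y) = val y * b by rewrite [in LHS](genP y) linearZ.
  have [|||c [cb bc] [xc cx]] := xloc b.
  + by rewrite /b -[LHS](hE e).
  + exact: val_x.
  + by exists s; rewrite -[b *: s]fE fh.
  apply: inj_surj_bij => [|y].
    apply: raddf_inj => y hy0; apply: val_inj.
    have -> : val y = val y * b * c by rewrite -mulrA bc val_x.
    by rewrite -hE hy0 mul0r.
  have ycx : (val y : A) * c * x = val y * c by rewrite -mulrA cx.
  by exists (mk _ ycx); apply: val_inj; rewrite hE /= -mulrA cb val_x.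
Qed.

End LocalIdempotent.

(** * Left ideals of a finite-dimensional algebra *)

Section FiniteDimensional.
Variables (K : fieldType) (A : algType K) (n : nat) (vA : Vector.axiom n A).

(** [A] with its structure of finite-dimensional vector space, which depends on the
chosen coordinates [vA]. *)
Definition vect_alg of Vector.axiom n A : Type := A.
HB.instance Definition _ := GRing.Algebra.on (vect_alg vA).
HB.instance Definition _ := Lmodule_hasFinDim.Build K (vect_alg vA) vA.

Local Notation B := (vect_alg vA).

Definition left_ideal (L : {vspace B}) : Prop :=
  forall a y : B, y \in L -> a * y \in L.

Lemma right_mult_linear (b : B) : linear (fun y : B => y * b).
Proof. by move=> k x y; rewrite mulrDl scalerAl. Qed.

Lemma right_mult (b : B) : exists f : 'End(B), forall y, f y = y * b.
Proof.
have [f fE] := linear_bundle (right_mult_linear b).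
by exists (linfun f) => y; rewrite lfunE fE.
Qed.

Lemma left_ideal_img (L : {vspace B}) (b : B) (f : 'End(B)) :
  (forall y, f y = y * b) -> left_ideal L -> left_ideal (f @: L)%VS.
Proof.
move=> fE Lid a _ /memv_imgP[y yL ->]; rewrite fE mulrA -fE.
exact/memv_img/Lid.
Qed.

Lemma left_ideal_add (L N : {vspace B}) :
  left_ideal L -> left_ideal N -> left_ideal (L + N)%VS.
Proof.
move=> Lid Nid a _ /memv_addP[u uL [v vN ->]]; rewrite mulrDr.
by apply: memv_add; [exact: Lid|exact: Nid].
Qed.

Lemma maximal_subspace (Q : {vspace B} -> Prop) (N0 : {vspace B}) :
  Q N0 -> exists2 N, Q N & forall L, Q L -> (N <= L)%VS -> L = N.
Proof.
move=> QN0; pose D d := `[< exists2 L, Q L & \dim L = d >].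
have exD : exists d, D d by exists (\dim N0); apply/asboolP; exists N0.
have D_le d : D d -> (d <= \dim {:B})%N.
  by move=> /asboolP[L _ <-]; apply/dimvS/subvf.
have [d /asboolP[N QN dN] d_max] := ex_maxnP exD D_le.
exists N => // L QL NL; apply/esym/eqP; rewrite eqEdim NL dN.
by apply: d_max; apply/asboolP; exists L.
Qed.

Lemma minimal_subspace (Q : {vspace B} -> Prop) (N0 : {vspace B}) :
  Q N0 -> exists2 N, Q N & forall L, Q L -> (L <= N)%VS -> L = N.
Proof.
move=> QN0; pose D d := `[< exists2 L, Q L & \dim L = d >].
have exD : exists d, D d by exists (\dim N0); apply/asboolP; exists N0.
have [d /asboolP[N QN dN] d_min] := ex_minnP exD.
exists N => // L QL LN; apply/eqP; rewrite eqEdim LN dN.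
by apply: d_min; apply/asboolP; exists L.
Qed.

(** Take the preimage [U] of a left ideal [N] that has maximal dimension among those
not containing the range of [f].  If [v] lies outside [U], then [N + A f(v)]
contains the range of [f], so every [x] is congruent to a multiple of [v]
modulo [U]. *)
Lemma maximal_submodule_of_linear_form (P : lmodType A) (f : {linear P -> A^o}) p :
  f p != 0 ->
  exists U : {pred P}, [/\ GRing.submod_closed U, exists q, q \notin U
    & forall V : {pred P}, GRing.submod_closed V -> {subset U <= V} ->
        forall v, v \in V -> v \notin U -> V =i predT].
Proof.
move=> fp0.
pose Q (N : {vspace B}) := left_ideal N /\ exists q, (f q : B) \notin N.
have Q0 : Q 0%VS.
  split=> [a y|]; first by rewrite !memv0 => /eqP->; rewrite mulr0.
  by exists p; rewrite memv0.
have [N [Nid [q fqN]] Nmax] := maximal_subspace Q0.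
exists (fun x => (f x : B) \in N); split; first split=> [|a x y xU yU].
- by rewrite unfold_in linear0; exact: mem0v.
- by rewrite unfold_in linearP; apply: memvD; [exact: Nid|].
- by exists q.
move=> V [V0 VZ] UV v vV vU x; rewrite [RHS]inE.
have [r rE] := right_mult (f v : B).
have N'id : left_ideal (N + limg r)%VS.
  by apply/left_ideal_add/(left_ideal_img rE) => // a y _; exact: memvf.
have N'fx : (f x : B) \in (N + limg r)%VS.
  apply: contrapT => /negP fxN'; move: vU; rewrite unfold_in => /negP[].
  rewrite -(Nmax (N + limg r)%VS) ?addvSl //; last by split=> //; exists x.
  by rewrite -[X in X \in _]mul1r -rE (subvP (addvSr _ _)) // memv_img ?memvf.
have [m mN [_ /memv_imgP[a _ ->] fxE]] := memv_addP N'fx.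
rewrite -[x](subrK ((a : A) *: v)) addrC; apply: VZ => //; apply: UV.
by rewrite unfold_in linearB linearZ /= fxE rE addrK.
Qed.

(** Let [L] be a left ideal of minimal dimension with [L S <> 0].  Whenever [b \in L]
and [L b] still acts nontrivially on [S], minimality forces [L b = L].  Applied
to an [e \in L] that fixes a nonzero vector [s], this yields [x] with [x e = e],
and [z |-> z e] is injective on [L] by equality of dimensions, so [x x = x].  Applied to
[b \in x A x] it yields left inverses, which are two-sided since a left inverse
has a left inverse too. *)
Lemma local_idempotent_exists (S : lmodType A) :
  simple_module S -> exists x : A, local_idempotent S x.
Proof.
move=> simS; have [t t0] := simS.1.
pose acts (L : {vspace B}) := left_ideal L /\
  exists y (s : S), y \in L /\ (y : A) *: s != 0.
have [|L [Lid [y [s [yL ys0]]]] Lmin] := @minimal_subspace acts fullv.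
  split=> [a z _|]; first exact: memvf.
  by exists 1, t; rewrite memvf scale1r.
have s0 : s != 0 by apply: contra_neq ys0 => ->; rewrite scaler0.
have mulL (b y' : B) (u : S) (f : 'End(B)) : (forall z, f z = z * b) ->
    b \in L -> y' \in L -> (y' * b : A) *: u != 0 -> (f @: L)%VS = L.
  move=> fE bL y'L ybu; apply: Lmin.
    split; first exact: left_ideal_img fE Lid.
    by exists (y' * b), u; split=> //; rewrite -fE; exact: memv_img.
  by apply/subvP => _ /memv_imgP[w wL ->]; rewrite fE; exact: Lid.
have divL (b y' z : B) (u : S) : b \in L -> y' \in L ->
    (y' * b : A) *: u != 0 -> z \in L -> exists2 c, c \in L & z = c * b.
  move=> bL y'L ybu zL; have [f fE] := right_mult b.
  move: zL; rewrite -{1}(mulL b y' u f) // => /memv_imgP[c cL ->].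
  by exists c.
have [a sE] := simple_generated s simS ys0.
pose e : B := a * y.
have eL : e \in L by exact: Lid.
have es : (e : A) *: s = s by rewrite [RHS]sE scalerA.
have ees : (e * e : A) *: s != 0 by rewrite -scalerA !es.
have [x xL xe] := divL e e e s eL eL ees eL.
have e_reg z : z \in L -> z * e = 0 -> z = 0.
  move=> zL ze0; have [f fE] := right_mult e.
  have := limg_ker_dim f L; rewrite (mulL e e s f) // -[RHS]add0n => /addIn.
  move=> /eqP; rewrite dimv_eq0 => /eqP kerL0.
  by apply/eqP; rewrite -memv0 -kerL0 memv_cap zL memv_ker fE ze0 eqxx.
have xs : (x : A) *: s = s by rewrite -[in LHS]es scalerA -xe es.
have xx : x * x = x.
  apply/eqP; rewrite -subr_eq0; apply/eqP/e_reg.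
    by apply: memvB => //; exact: Lid.
  by rewrite mulrBl -mulrA -!xe subrr.
(* A left inverse [c] of [b] in [L] is brought into [x A x] as [x c x]. *)
have left_inv (b : A) : x * b = b -> b * x = b ->
    (exists u : S, b *: u != 0) -> exists2 c : A, c * b = x & x * c = c /\ c * x = c.
  move=> xb bx [u bu].
  have bL : (b : B) \in L by rewrite -bx; exact: Lid.
  have xbu : (x * b : A) *: u != 0 by rewrite xb.
  have [c cL xE] := divL b x x u bL xL xbu xL.
  exists (x * c * x); rewrite -!mulrA ?xx ?mulrA ?xx //.
  by rewrite -!mulrA xb -xE xx.
exists x; split=> //; first by exists s; rewrite xs.
move=> b xb bx [u bu]; have [c cb [xc cx]] := left_inv b xb bx (ex_intro _ u bu).
have c_acts : exists w : S, c *: w != 0.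
  exists (b *: u); rewrite scalerA cb; apply: contra_neq bu => xu0.
  by rewrite -bx -scalerA xu0 scaler0.
have [d dc [xd dx]] := left_inv c xc cx c_acts.
exists c => //; split=> //.
by rewrite -[b]xb -dc -!mulrA (mulrA c) cb xc dc.
Qed.

End FiniteDimensional.

(** * The bijection *)

Lemma projective_simple_quotient (K : fieldType) (A : algType K) (P : lmodType A) :
  finite_dimensional A -> projective_module P -> nonzero_module P ->
  exists (S : lmodType A) (f : {linear P -> S}), simple_module S /\ surjective_hom f.
Proof.
move=> [n [vA]] projP [p p0]; have [phi phip0] := projective_linear_form projP p0.
have [U [hU [q qU] Umax]] := maximal_submodule_of_linear_form vA phip0.
have [f [fS _]] := quotient_projection hU.
by exists (quotient_module hU), f; split=> //; exact: maximal_quotient_simple qU Umax.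
Qed.

Lemma simple_local_cover (K : fieldType) (A : algType K) (S : lmodType A) :
  finite_dimensional A -> simple_module S ->
  exists (P : lmodType A) (f : {linear P -> S}),
    projective_indecomposable P /\ local_cover f.
Proof.
move=> [n [vA]] simS; have [x xloc] := local_idempotent_exists vA simS.
exact: local_idempotent_cover xloc.
Qed.

(** A relation that determines each of its two sides up to isomorphism from the other
is the graph of a bijection between isomorphism classes. *)
Lemma iso_classes_bijection (A : pzRingType) (Q Q' : lmodType A -> Prop)
    (R : lmodType A -> lmodType A -> Prop) :
  (forall M, Q M -> exists2 N, Q' N & R M N) ->
  (forall N, Q' N -> exists2 M, Q M & R M N) ->
  (forall M N N', Q M -> Q' N -> Q' N' -> R M N ->
     R M N' <-> isomorphic_modules N N') ->
  (forall M M' N, Q M -> Q M' -> Q' N -> R M N ->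
     R M' N <-> isomorphic_modules M M') ->
  exists F : iso_classes Q -> iso_classes Q', bijective F /\
    forall M N (hM : Q M) (hN : Q' N), F (iso_class hM) = iso_class hN <-> R M N.
Proof.
move=> ex_right ex_left unique_right unique_left.
have exF (C : iso_classes Q) : exists D : iso_classes Q',
    forall M N (hM : Q M) (hN : Q' N), C = iso_class hM -> D = iso_class hN <-> R M N.
  have [M [hM ->]] := iso_classP C; have [N hN MN] := ex_right M hM.
  exists (iso_class hN) => M' N' hM' hN' /iso_class_eq MM'.
  have M'N : R M' N by exact/(unique_left M M' N).
  by rewrite iso_class_eq; apply: iff_sym; exact: unique_right.
pose F C := sval (cid (exF C)).
have FP M N (hM : Q M) (hN : Q' N) : F (iso_class hM) = iso_class hN <-> R M N.
  exact: (svalP (cid (exF (iso_class hM)))).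
exists F; split=> //; apply: inj_surj_bij => [C C' | D].
  have [M [hM ->]] := iso_classP C; have [M' [hM' ->]] := iso_classP C'.
  have [N [hN FN]] := iso_classP (F (iso_class hM)); rewrite FN.
  move=> /esym/FP M'N; apply/iso_class_eq.
  by apply/(unique_left M M' N) => //; apply/FP.
have [N [hN ->]] := iso_classP D; have [M hM MN] := ex_left N hN.
by exists (iso_class hM); apply/FP.
Qed.

Theorem theorem7p1 (K : fieldType) (A : algType K) (hA : finite_dimensional A) :
  exists F : iso_classes (@projective_indecomposable A) ->
             iso_classes (@simple_module A),
    bijective F /\
    forall (P S : lmodType A)
           (hP : projective_indecomposable P) (hS : simple_module S),
      F (iso_class hP) = iso_class hS <->
      exists f : {linear P -> S}, surjective_hom f.
Proof.
have cover_iso (P P' S : lmodType A) (f : {linear P -> S}) (f' : {linear P' -> S}) :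
    simple_module S -> projective_indecomposable P -> projective_indecomposable P' ->
    surjective_hom f -> surjective_hom f' -> isomorphic_modules P P'.
  move=> simS hP hP' fS f'S; have [L [l [hL lloc]]] := simple_local_cover hA simS.
  apply: (@iso_trans _ _ L); first apply: iso_sym.
    exact: local_cover_unique simS.1 hL.1 lloc hP fS.
  exact: local_cover_unique simS.1 hL.1 lloc hP' f'S.
apply: iso_classes_bijection.
- move=> P [projP [P0 _]].
  have [S [f [simS fS]]] := projective_simple_quotient hA projP P0.
  by exists S => //; exists f.
- move=> S simS; have [P [f [hP [fS _]]]] := simple_local_cover hA simS.
  by exists P => //; exists f.
- move=> P S S' hP simS simS' [f fS]; split=> [[f' f'S]|[i [j _ jK]]]; last first.
    exists (i \o f : {linear _ -> _}) => y; have [p fp] := fS (j y).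
    by exists p; rewrite /= fp jK.
  have [L [l [hL lloc]]] := simple_local_cover hA simS'.
  have [i [j _ jK]] := cover_iso _ _ _ _ _ simS' hL hP lloc.1 f'S.
  apply: (local_cover_top_unique simS simS' hL.1 _ lloc (f := f \o i)).
  by move=> y; have [p fp] := fS y; exists (j p); rewrite /= jK.
- move=> P P' S hP hP' simS [f fS]; split=> [[f' f'S]|/iso_sym[i [j _ jK]]].
    exact: cover_iso simS hP hP' fS f'S.
  exists (f \o i : {linear _ -> _}) => y; have [p fp] := fS y.
  by exists (j p); rewrite /= jK.
Qed.
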